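(* Let $\mu>0$, $\kappa>0$, $k>0$, $\widehat k>0$. For every dimension $n\in\mathbb{N}$ and every $q\ge 1$ there are constants $K_1,K_2>0$ such that for all symmetric positive definite $U\in\mathbb{R}^{n\times n}$ $$\frac{\mu}{k}\,e^{k\,\|\mathrm{dev}_n\log U\|^2}+\frac{\kappa}{2\widehat k}\,e^{\widehat k\,|\mathrm{tr}(\log U)|^2}\ \ge\ K_1\,\|U-I\|^q-K_2 .$$
   Context: For $X\in\mathbb{R}^{n\times n}$, $\|X\|=\sqrt{\mathrm{tr}(XX^T)}$ is the Frobenius norm and $\mathrm{dev}_nX=X-\frac1n\mathrm{tr}(X)\,I$, with $I$ the identity matrix. $\log U$ is the principal (symmetric) matrix logarithm of the symmetric positive definite matrix $U$. *)

(* Defs.v *)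
From mathcomp Require Import all_boot all_order all_algebra.
From mathcomp Require Import all_classical all_reals all_analysis.

Set Implicit Arguments.
Unset Strict Implicit.
Unset Printing Implicit Defensive.

Import Order.TTheory GRing.Theory Num.Theory.
Import numFieldNormedType.Exports.

Local Open Scope classical_set_scope.
Local Open Scope ring_scope.

(* The library norm `|X| on matrices is the maximum norm, not this one. *)
Definition frobenius {R : realType} {n : nat} (X : 'M[R]_n) : R :=
  Num.sqrt (\tr (X *m X^T)).

Definition dev {R : realType} {n : nat} (X : 'M[R]_n) : 'M[R]_n :=
  X - (n%:R^-1 * \tr X) *: 1%:M.

Definition sym_posdef {R : realType} {n : nat} (U : 'M[R]_n) : Prop :=
  U \is symmetricmx /\
  (forall x : 'cV[R]_n, x != 0 -> 0 < (x^T *m U *m x) ord0 ord0).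

Definition expmx {R : realType} {n : nat} (A : 'M[R]_n) : 'M[R]_n :=
  limn (series (fun m : nat => (m`!%:R : R)^-1 *: A ^+ m)).

(* A symmetric positive definite U has exactly one symmetric L with
   expmx L = U, its principal logarithm. The value 0 is a default, used only
   when no such L exists (i.e. U not symmetric positive definite). *)
Definition logmx {R : realType} {n : nat} (U : 'M[R]_n) : 'M[R]_n :=
  xget 0 [set L : 'M[R]_n | L \is symmetricmx /\ expmx L = U].

(* Main.v *)
(** A real symmetric matrix is similar, over the reals, to a real diagonal
    matrix. So a symmetric logarithm of [U = P^-1 diag(e) P] exists, namely
    [P^-1 diag(ln e) P], and [logmx U] is not its default value. Writing now
    [logmx U = P^-1 diag(d) P], every quantity in the statement is a trace,
    hence a symmetric function of the eigenvalues [d_i]: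
    [|U - 1|^2 = sum (e^(d_i) - 1)^2] and
    [|dev (log U)|^2 = sum (d_i - tr d / n)^2].
    With [f = |dev (log U)|] and [t = |tr (log U)|] one gets [|d_i| <= f + t],
    so [|U - 1| <= n e^(f + t)] and [|U - 1|^q <= n^q (e^(2qf) + e^(2qt))].
    Completing the square, [2 q x <= k x^2 + q^2 / k], finishes the proof. *)

From HB Require Import structures.
Require Import Defs.
From mathcomp Require Import all_boot all_order all_algebra.
From mathcomp Require Import all_classical all_reals all_analysis.
From mathcomp Require Import complex ring lra.

Import Order.TTheory GRing.Theory Num.Theory.
Import numFieldNormedType.Exports.

Local Open Scope ring_scope.

Definition diag_conj {R : realType} {n : nat} (P : 'M[R]_n) (d : 'rV[R]_n) :
  'M[R]_n := invmx P *m diag_mx d *m P.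

Lemma symmetricmxE (R : fieldType) (n : nat) (A : 'M[R]_n) :
  (A \is symmetricmx) = (A^T == A).
Proof.
by rewrite qualifE /= expr0 scale1r map_mx_id // eq_sym.
Qed.

(* The spectral theorem is only available over R[i]; since both sides are real,
   [real_similar] turns the complex change of basis into a real one. *)
Lemma symmetric_diag_conj (R : realType) (n : nat) (A : 'M[R]_n) :
  A \is symmetricmx ->
  exists2 P : 'M[R]_n, P \in unitmx & exists d, A = diag_conj P d.
Proof.
move=> sA; pose c := real_complex R; pose C := map_mx c A.
have realC m p (B : 'M[R]_(m, p)) : map_mx c B \is a mxOver Num.real.
  by apply/mxOverP => i j; rewrite mxE complex_real.
have sC : C \is symmetricmx.
  by move: sA; rewrite !symmetricmxE /C map_trmx => /eqP ->.
have hC := realsym_hermsym sC (realC _ _ A).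
have /orthomx_spectralP dC := hermitian_normalmx hC.
have rd := hermitian_spectral_diag_real hC.
have rD : diag_mx (spectral_diag C) \is a mxOver Num.real.
  by apply/mxOverP => i j; rewrite mxE rpredMn ?(mxOverP rd).
have simCD : exists2 Q, Q \in unitmx & similar Q C (diag_mx (spectral_diag C)).
  exists (spectralmx C); first exact: spectral_unit.
  apply/similarP; rewrite ?spectral_unit //.
  by rewrite {2}dC -!mulmxA mulKVmx ?spectral_unit.
have [Q /andP[Qr Qu] /(similarP Qu) CQ] := real_similar simCD (realC _ _ A) rD.
(* [Q] and the eigenvalues have real entries, so the relation is the image under [c] of one over
   [R], and [map_mx c] is injective. *)
have lift m p (B : 'M[R[i]]_(m, p)) : B \is a mxOver Num.real ->
    B = map_mx c (map_mx (@complex.Re R) B).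
  by move=> /mxOverP rB; apply/matrixP => i j; rewrite !mxE /c RRe_real.
rewrite (lift _ _ _ Qr) in Qu CQ; rewrite (lift _ _ _ rd) in CQ.
set P := map_mx _ Q in Qu CQ; set d := map_mx _ (spectral_diag C) in CQ.
rewrite map_unitmx in Qu.
move: CQ; rewrite -map_diag_mx -!map_mxM => /map_mx_inj PA.
by exists P => //; exists d; rewrite /diag_conj -mulmxA -PA mulKmx.
Qed.

(* [P] need not be orthogonal: [P^-1 diag(e) P] is symmetric iff [diag(e)]
   commutes with [P P^T], i.e. [P P^T] only links indices where [e] agrees, a
   property that [e] passes on to [f e]. *)
Lemma symmetric_diag_conj_map (R : realType) (n : nat) (P : 'M[R]_n) d
    (f : R -> R) : P \in unitmx ->
  diag_conj P d \is symmetricmx -> diag_conj P (map_mx f d) \is symmetricmx.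
Proof.
move=> Pu; rewrite !symmetricmxE /diag_conj.
(* Multiplying by [P] on the left and [P^T] on the right clears the inverses. *)
have symE (e : 'rV[R]_n) :
    ((invmx P *m diag_mx e *m P)^T == invmx P *m diag_mx e *m P) =
    (diag_mx e *m (P *m P^T) == P *m P^T *m diag_mx e).
  have PTu : P^T \in unitmx by rewrite unitmx_tr.
  rewrite !trmx_mul tr_diag_mx trmx_inv.
  apply/eqP/eqP => [H|H].
    move/(congr1 (fun X => P *m (X *m P^T))) : H.
    by rewrite -!mulmxA mulVmx // mulmx1 mulKVmx // !mulmxA => <-.
  apply: (can_inj (mulKmx Pu)); apply: (can_inj (mulmxK PTu)).
  by rewrite -!mulmxA mulVmx // mulmx1 mulKVmx // !mulmxA -H mulmxA.
rewrite !symE => /eqP/matrixP H; apply/eqP/matrixP => i j.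
move: (H i j); rewrite !mul_diag_mx !mul_mx_diag !mxE.
rewrite [X in _ = X]mulrC => /eqP; rewrite -subr_eq0 -mulrBl mulf_eq0 subr_eq0.
by case/orP => /eqP ->; rewrite ?mulr0 ?mul0r // mulrC.
Qed.

(** Row [i] of [P] is a left eigenvector for [d 0 i], so the quadratic form there equals [d 0 i]
    times a sum of squares. *)
Lemma posdef_diag_conj_gt0 (R : realType) (n : nat) (P : 'M[R]_n) d i :
  P \in unitmx -> sym_posdef (diag_conj P d) -> 0 < d 0 i.
Proof.
move=> Pu [_ /(_ (row i P)^T)]; rewrite trmxK.
have r0 : row i P != 0.
  apply: contraTneq Pu => Pi0; apply/negP => Pu.
  have /rowP/(_ i) : row i (1%:M : 'M[R]_n) = 0.
    by rewrite -(mulmxV Pu) row_mul Pi0 mul0mx.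
  by rewrite !mxE eqxx; apply/eqP; rewrite oner_neq0.
have -> : row i P *m diag_conj P d = d 0 i *: row i P.
  rewrite /diag_conj -row_mul -mulmxA mulKVmx // mul_diag_mx.
  by apply/rowP => j; rewrite !mxE.
rewrite trmx_eq0 => /(_ r0); rewrite -scalemxAl mxE.
suff s0 : 0 <= (row i P *m (row i P)^T) 0 0.
  by move=> dr; rewrite ltNge; apply/negP => dle; move: dr; rewrite ltNge
    mulr_le0_ge0.
by rewrite mxE sumr_ge0 // => j _; rewrite !mxE -expr2 sqr_ge0.
Qed.

Lemma diag_conjX (R : realType) (n : nat) (P : 'M[R]_n) d m : P \in unitmx ->
  diag_conj P d ^+ m = diag_conj P (map_mx (fun x => x ^+ m) d).
Proof.
move=> Pu; elim: m => [|m IH].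
  rewrite expr0 /diag_conj (_ : map_mx _ d = const_mx 1).
    by rewrite diag_const_mx mulmx1 mulVmx.
  by apply/rowP => i; rewrite !mxE.
rewrite exprS IH /diag_conj -[LHS]/(_ *m _) !mulmxA mulmxK //.
rewrite -(mulmxA (invmx P) (diag_mx d)) mulmx_diag.
by congr (_ *m diag_mx _ *m _); apply/rowP => i; rewrite !mxE exprS.
Qed.

Lemma diag_conj_is_linear (R : realType) (n : nat) (P : 'M[R]_n) :
  linear (diag_conj P).
Proof.
move=> a u v; rewrite /diag_conj raddfD /= linearZ /= mulmxDr mulmxDl.
by rewrite -scalemxAr -scalemxAl.
Qed.

HB.instance Definition _ (R : realType) (n : nat) (P : 'M[R]_n) :=
  GRing.isLinear.Build R 'rV[R]_n 'M[R]_n *:%R (diag_conj P)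
    (diag_conj_is_linear R n P).

(** A matrix neighbourhood contains a product of entrywise ones, and a filter is stable under this
    finite intersection. *)
Lemma cvg_mx_entry (K : numFieldType) m n (T : Type) (F : set_system T)
    (FF : Filter F) (u : T -> 'M[K]_(m, n)) (M : 'M[K]_(m, n)) :
  (forall i j, (u t i j @[t --> F] --> M i j)%classic) ->
  (u t @[t --> F] --> M)%classic.
Proof.
move=> uM A [B MB BA]; apply: filterS (BA : (_ `<=` A)%classic) _.
have : \forall t \near F, forall ij : 'I_m * 'I_n,
    B ij.1 ij.2 (u t ij.1 ij.2).
  by apply: filter_forall => -[i j]; exact: uM (MB i j).
by apply: filterS => t /= H i j; exact: (H (i, j)).
Qed.

(** By linearity of [diag_conj P], each entry of a partial sum is a fixed linear combination of
    scalar exponential partial sums. *)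
Lemma expmx_diag_conj (R : realType) (n : nat) (P : 'M[R]_n) d :
  P \in unitmx -> expmx (diag_conj P d) = diag_conj P (map_mx expR d).
Proof.
move=> Pu; apply: cvg_lim; first exact: norm_hausdorff.
have -> : series (fun m => (m`!%:R : R)^-1 *: diag_conj P d ^+ m) =
    (fun N => diag_conj P (map_mx (fun x => series (exp_coeff x) N) d)).
  apply/funext => N; rewrite /series /=.
  under eq_bigr do rewrite diag_conjX // -linearZ.
  rewrite -linear_sum; congr diag_conj; apply/rowP => i.
  rewrite summxE !mxE; apply: eq_bigr => m _.
  by rewrite !mxE /exp_coeff /= mulrC.
have entryE (e : 'rV[R]_n) i j :
    diag_conj P e i j = \sum_k (invmx P i k * P k j) * e 0 k.
  rewrite /diag_conj mul_mx_diag mxE; apply: eq_bigr => k _.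
  by rewrite mxE mulrAC.
apply: cvg_mx_entry => i j; rewrite entryE; under eq_fun do rewrite entryE.
apply: cvg_big => [|k _]; first exact: add_continuous.
apply: cvgM; first exact: cvg_cst.
rewrite mxE; under eq_fun do rewrite mxE.
exact: is_cvg_series_exp_coeff.
Qed.

Lemma logmx_spec (R : realType) (n : nat) (U : 'M[R]_n) : sym_posdef U ->
  logmx U \is symmetricmx /\ expmx (logmx U) = U.
Proof.
move=> pU; have [sU _] := pU.
have [P Pu [d UE]] := symmetric_diag_conj R n U sU.
apply: (@xgetPex _ _
  [set L : 'M[R]_n | L \is symmetricmx /\ expmx L = U]%classic).
exists (diag_conj P (map_mx (@ln R) d)); split.
  by apply: symmetric_diag_conj_map; rewrite // -UE.
rewrite expmx_diag_conj // UE; congr diag_conj; apply/rowP => i.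
rewrite !mxE lnK // posrE; apply: (posdef_diag_conj_gt0 R n P) => //.
by rewrite -UE.
Qed.

(** Symmetry turns [X *m X^T] into [X ^+ 2], whose trace is invariant under any similarity,
    orthogonal or not. *)
Lemma frobenius_diag_conj (R : realType) (n : nat) (P : 'M[R]_n) d :
  P \in unitmx -> diag_conj P d \is symmetricmx ->
  frobenius (diag_conj P d) = Num.sqrt (\sum_i d 0 i ^+ 2).
Proof.
move=> Pu; rewrite symmetricmxE => /eqP sA; rewrite /frobenius sA.
rewrite -[_ *m _]/(diag_conj P d ^+ 2) diag_conjX // /diag_conj mxtrace_mulC.
rewrite mulmxA mulmxV // mul1mx mxtrace_diag.
by under eq_bigr do rewrite mxE.
Qed.

Lemma mxtrace_diag_conj (R : realType) (n : nat) (P : 'M[R]_n) d :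
  P \in unitmx -> \tr (diag_conj P d) = \sum_i d 0 i.
Proof.
by move=> Pu; rewrite /diag_conj mxtrace_mulC mulmxA mulmxV // mul1mx
  mxtrace_diag.
Qed.

Lemma diag_conj_scalar (R : realType) (n : nat) (P : 'M[R]_n) a :
  P \in unitmx -> diag_conj P (const_mx a) = a%:M.
Proof.
by move=> Pu; rewrite /diag_conj diag_const_mx mul_mx_scalar -scalemxAl
  mulVmx // scalemx1.
Qed.

Lemma ler_frobenius_logmx (R : realType) (n : nat) (U : 'M[R]_n) :
  (0 < n)%N -> sym_posdef U ->
  frobenius (U - 1%:M) <=
  n%:R * expR (frobenius (dev (logmx U)) + `|\tr (logmx U)|).
Proof.
move=> n0 pU; have [sL expL] := logmx_spec R n U pU.
have [sU _] := pU; set L := logmx U in sL expL *.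
have [P Pu [d LE]] := symmetric_diag_conj R n L sL.
rewrite LE in sL; set a := n%:R^-1 * \tr L.
have devE : dev L = diag_conj P (map_mx (fun x => x - a) d).
  rewrite /dev -/a scalemx1 LE -(diag_conj_scalar _ _ P) // -linearB.
  by congr diag_conj; apply/rowP => i; rewrite !mxE.
have UE : U - 1%:M = diag_conj P (map_mx (fun x => expR x - 1) d).
  rewrite -expL LE expmx_diag_conj // -(diag_conj_scalar _ _ P) // -linearB.
  by congr diag_conj; apply/rowP => i; rewrite !mxE.
set r := frobenius _ + _.
have d_le i : `|d 0 i| <= r.
  (* The square of [d 0 i - a] is one term of the sum under the root; [a] is bounded by the trace
     since [n%:R^-1 <= 1]. *)
  have -> : d 0 i = (d 0 i - a) + a by rewrite subrK.
  apply: le_trans (ler_normD _ _) (lerD _ _).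
    rewrite devE frobenius_diag_conj ?symmetric_diag_conj_map //.
    rewrite -sqrtr_sqr ler_sqrt ?sqr_ge0 //; last first.
      by apply: sumr_ge0 => j _; exact: sqr_ge0.
    rewrite (bigD1 i) //= mxE lerDl.
    by apply: sumr_ge0 => j _; exact: sqr_ge0.
  rewrite /a normrM -[leRHS]mul1r ler_wpM2r //.
  by rewrite ger0_norm ?invr_ge0 // invf_le1 ?ler1n ?ltr0n.
rewrite UE frobenius_diag_conj ?symmetric_diag_conj_map //.
have nr0 : 0 <= n%:R * expR r by rewrite mulr_ge0 // expR_ge0.
rewrite -(ger0_norm nr0) -sqrtr_sqr ler_sqrt ?sqr_ge0 //.
(* Both [expR (d 0 i)] and [1] lie between [0] and [expR r], hence so does the absolute value of
   their difference. The [n] equal terms are then absorbed by [n <= n ^ 2]. *)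
apply: (@le_trans _ _ (\sum_(i < n) expR r ^+ 2)).
  apply: ler_sum => i _; rewrite mxE -[leLHS]real_normK ?num_real //.
  rewrite ler_sqr ?nnegrE ?expR_ge0 // ler_norml.
  have := d_le i; rewrite ler_norml => /andP[_ dr].
  have := expR_ge0 (d 0 i).
  have r0 : 0 <= r by exact: le_trans (d_le i).
  have : expR (d 0 i) <= expR r by rewrite ler_expR.
  have : 1 <= expR r by rewrite -[1]expR0 ler_expR.
  by move=> ? ? ?; apply/andP; split; lra.
rewrite sumr_const card_ord -[leLHS]mulr_natl exprMn ler_wpM2r ?sqr_ge0 //.
by rewrite expr2 ler_peMr // ler1n.
Qed.

Lemma expR_linear_le_sqr (R : realType) (q k x : R) : 0 < k ->
  expR (2 * q * x) <= expR (q ^+ 2 / k) * expR (k * x ^+ 2).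
Proof.
move=> k0; rewrite -expRD ler_expR -subr_ge0.
suff -> : q ^+ 2 / k + k * x ^+ 2 - 2 * q * x = (k * x - q) ^+ 2 / k.
  by rewrite divr_ge0 ?sqr_ge0 // ltW.
by field; rewrite gt_eqF.
Qed.

Theorem theorem4p9 (R : realType) (mu kappa k khat : R)
    (hmu : 0 < mu) (hkappa : 0 < kappa) (hk : 0 < k) (hkhat : 0 < khat) :
  forall (n : nat) (q : R), (0 < n)%N -> 1 <= q ->
  exists K1 K2 : R, [/\ 0 < K1, 0 < K2 &
    forall U : 'M[R]_n, sym_posdef U ->
      K1 * frobenius (U - 1%:M) `^ q - K2 <=
      mu / k * expR (k * frobenius (dev (logmx U)) ^+ 2)
      + kappa / (2 * khat) * expR (khat * `|\tr (logmx U)| ^+ 2)].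
Proof.
move=> n q n0 q1; have q0 : 0 <= q by exact: le_trans q1.
(* [c1] and [c2] absorb the constant factors left by completing the square; their minimum serves
   both exponentials at once. *)
pose c1 := mu / k / expR (q ^+ 2 / k).
pose c2 := kappa / (2 * khat) / expR (q ^+ 2 / khat).
have c10 : 0 < c1 by rewrite !divr_gt0 ?expR_gt0.
have c20 : 0 < c2 by rewrite !divr_gt0 ?expR_gt0 // mulr_gt0.
have c0 : 0 < Num.min c1 c2 by rewrite lt_min c10.
have nq0 : 0 < n%:R `^ q :> R by rewrite powR_gt0 ?ltr0n.
exists (Num.min c1 c2 / n%:R `^ q), 1; split=> [||U pU].
- exact: divr_gt0.
- exact: ltr01.
set f := frobenius (dev _); set t := `|_|.
have frob_le : frobenius (U - 1%:M) `^ q <=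
    n%:R `^ q * (expR (2 * q * f) + expR (2 * q * t)).
  apply: (@le_trans _ _ ((n%:R * expR (f + t)) `^ q)).
    by rewrite ge0_ler_powR ?ler_frobenius_logmx // nnegrE
      ?sqrtr_ge0 ?mulr_ge0 ?expR_ge0.
  rewrite powRM ?expR_ge0 // ler_pM2l // -expRM.
  have -> : (f + t) * q = q * f + q * t by ring.
  have sqE x : expR (2 * q * x) = expR (q * x) ^+ 2.
    by rewrite -expRM_natl -mulrA.
  (* What remains is [x * y <= x ^+ 2 + y ^+ 2]. *)
  rewrite expRD !sqE; move: (expR _) (expR _) => x y; nra.
apply: (@le_trans _ _ (Num.min c1 c2 * (expR (2 * q * f) + expR (2 * q * t)))).
  apply: (@le_trans _ _
    (Num.min c1 c2 / n%:R `^ q * frobenius (U - 1%:M) `^ q)).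
    by rewrite lerBlDr lerDl.
  by rewrite -mulrA ler_pM2l // mulrC ler_pdivrMr // mulrC.
have step c c' k' x : 0 < c -> 0 < k' -> c' <= c / expR (q ^+ 2 / k') ->
    c' * expR (2 * q * x) <= c * expR (k' * x ^+ 2).
  move=> cp kp c'c; apply: (@le_trans _ _
    (c / expR (q ^+ 2 / k') * (expR (q ^+ 2 / k') * expR (k' * x ^+ 2)))).
    apply: le_trans (ler_wpM2r (expR_ge0 _) c'c) _.
    by rewrite ler_wpM2l ?expR_linear_le_sqr // divr_ge0 ?expR_ge0 // ltW.
  by rewrite mulrA divfK ?gt_eqF ?expR_gt0.
rewrite mulrDr lerD //; apply: step => //.
- exact: divr_gt0.
- by rewrite -/c1 ge_min lexx.
- by rewrite divr_gt0 // mulr_gt0.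
- by rewrite -/c2 ge_min lexx orbT.
Qed.
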